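(* Let $D\in\mathbb{R}^{n\times n}$ be symmetric, let $\lambda$ be an eigenvalue of $D$ of maximal absolute value and let $Z_\lambda\subseteq\mathcal{S}$ be the set of associated normalized eigenvectors. If $\lambda>0$, then the measures $\mu^*=\delta_z$ with $z\in Z_\lambda$ are the only maximizers of the energy $\mathcal{E}_D$ over $\mathcal{P}(\mathcal{S})$ (that is, a measure is a maximizer if and only if it is of this form). If $\lambda<0$, then the measures $\mu^*=\delta_z$ with $z\in Z_\lambda$ are the only minimizers of $\mathcal{E}_D$ over $\mathcal{P}(\mathcal{S})$.
   Context: $\mathcal{S}=\{x\in\mathbb{R}^n:\|x\|=1\}$ is the Euclidean unit sphere, $\mathcal{P}(\mathcal{S})$ the set of Borel probability measures on $\mathcal{S}$, $\delta_z$ the Dirac measure at $z$, and $$\mathcal{E}_D(\mu)=\int_{\mathcal{S}}\int_{\mathcal{S}}e^{x\cdot Dy}\,d\mu(x)\,d\mu(y).$$ *)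

(* Defs.v *)
From HB Require Import structures.
From mathcomp Require Import all_boot all_order all_algebra.
From mathcomp Require Import all_classical all_reals all_analysis.
Set Implicit Arguments.
Unset Strict Implicit.
Unset Printing Implicit Defensive.
Import Order.TTheory GRing.Theory Num.Theory.
Import numFieldNormedType.Exports.
Local Open Scope classical_set_scope.
Local Open Scope ring_scope.

Definition dotv (R : realType) (n : nat) (x y : 'cV[R]_n) : R :=
  \sum_(i < n) x i 0 * y i 0.

(* The library's norm on matrices is the sup norm, whence this definition; both
   norms induce the topology used below. *)
Definition enorm (R : realType) (n : nat) (x : 'cV[R]_n) : R :=
  Num.sqrt (dotv x x).

Definition unit_sphere (R : realType) (n : nat) : set 'cV[R]_n :=
  [set x | enorm x = 1].

(* Measurable types are inhabited in the library, hence the dimension n.+1: in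
   dimension 0 the sphere is empty and a matrix has no eigenvalue. *)
Definition sphere (R : realType) (n : nat) : Type :=
  set_type (@unit_sphere R n.+1).

HB.instance Definition _ (R : realType) (n : nat) :=
  Topological.copy (sphere R n) (set_type (@unit_sphere R n.+1)).

Definition sphere_val (R : realType) (n : nat) (x : sphere R n) :
  'cV[R]_n.+1 := set_val x.

Lemma unit_sphere_delta (R : realType) (n : nat) :
  (delta_mx 0 0 : 'cV[R]_n.+1) \in @unit_sphere R n.+1.
Proof.
rewrite inE /unit_sphere /= /enorm /dotv (bigD1 0)//= big1 => [|i ni].
  by rewrite !mxE !eqxx /= mulr1 addr0 sqrtr1.
by rewrite !mxE (negbTE ni) mul0r.
Qed.

HB.instance Definition _ (R : realType) (n : nat) :=
  isPointed.Build (sphere R n)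
    (exist _ (delta_mx 0 0) (unit_sphere_delta R n)).

Definition borel_sphere (R : realType) (n : nat) :=
  g_sigma_algebraType (@open (sphere R n)).

Definition energy (R : realType) (n : nat) (D : 'M[R]_n.+1)
    (mu : probability (borel_sphere R n) R) : \bar R :=
  (\int[mu]_y \int[mu]_x
     (expR (dotv (sphere_val x) (D *m sphere_val y)))%:E)%E.

Definition energy_maximizer (R : realType) (n : nat) (D : 'M[R]_n.+1)
    (mu : probability (borel_sphere R n) R) : Prop :=
  forall nu : probability (borel_sphere R n) R,
    (energy D nu <= energy D mu)%E.

Definition energy_minimizer (R : realType) (n : nat) (D : 'M[R]_n.+1)
    (mu : probability (borel_sphere R n) R) : Prop :=
  forall nu : probability (borel_sphere R n) R,
    (energy D mu <= energy D nu)%E.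

Definition max_abs_eigenvalue (R : realType) (n : nat) (D : 'M[R]_n)
    (lambda : R) : Prop :=
  eigenvalue D lambda /\
  (forall a : R, eigenvalue D a -> `|a| <= `|lambda|).

(* [eigenvalue] refers to row vectors; for symmetric D this is the same. *)
Definition unit_eigenvectors (R : realType) (n : nat) (D : 'M[R]_n.+1)
    (lambda : R) : set (borel_sphere R n) :=
  [set z | D *m sphere_val z = lambda *: sphere_val z].

(* Library measures are functions on all sets, constrained only on measurable
   ones, so measures are compared on measurable sets. *)
Definition is_dirac (R : realType) (n : nat)
    (mu : probability (borel_sphere R n) R) (z : borel_sphere R n) : Prop :=
  forall A : set (borel_sphere R n), measurable A -> mu A = \d_z A.

(* Main.v *)
Require Import Defs.
From mathcomp Require Import all_boot all_order all_algebra.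
From mathcomp Require Import all_classical all_reals all_analysis.
From mathcomp Require Import measurable_realfun ring lra.
Set Implicit Arguments.
Unset Strict Implicit.
Unset Printing Implicit Defensive.
Import Order.TTheory GRing.Theory Num.Theory.
Import numFieldNormedType.Exports.
Local Open Scope classical_set_scope.
Local Open Scope ring_scope.

(** Since lambda has maximal absolute value, |D y| <= |lambda| |y| for all y,
    so by Cauchy-Schwarz x . D y lies between -|lambda| and |lambda| for unit
    vectors x and y; one of these two ends is lambda itself.  The energy is
    therefore at most (lambda > 0) or at least (lambda < 0) exp lambda, and a
    Dirac mass at a unit eigenvector z attains this bound because
    z . D z = lambda.

    Conversely, if a measure attains the bound, then the mean of
    exp (x . D y) is extremal, so the integrand equals exp lambda almost
    everywhere ([mean_extremal_ae], applied to the outer and then to the inner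
    integral).  For one such y, almost every x satisfies x . D y = lambda,
    which is the equality case of Cauchy-Schwarz and gives D y = lambda x
    ([dotv_mulmx_extremal]).  As lambda <> 0, this determines x: the measure
    is a Dirac mass at some z, and the same equality case with x = y = z makes
    z an eigenvector.  This only needs exp lambda to be one of the two extreme
    values, whichever it is, so both halves share [energy_eq_expR].

    The bound on |D y| ([symmetric_norm_bound]) is obtained without
    diagonalizing D.  The continuous function |D v|^2 attains its maximum m on
    the compact unit sphere; criticality makes the maximizer an eigenvector of
    D^2 for m, and factoring D^2 - m shows that one of the two square roots of
    m is an eigenvalue of D, whence m <= lambda^2. *)

(** * The Euclidean dot product *)

Section DotProduct.
Context {R : realType} {n : nat}.
Implicit Types (x y z : 'cV[R]_n) (D : 'M[R]_n).

Lemma dotvE x y : dotv x y = (x^T *m y) 0 0.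
Proof. by rewrite mxE; apply: eq_bigr => i _; rewrite mxE. Qed.

Lemma dotvC x y : dotv x y = dotv y x.
Proof. by apply: eq_bigr => i _; rewrite mulrC. Qed.

Lemma dotvDr x y z : dotv x (y + z) = dotv x y + dotv x z.
Proof. by rewrite !dotvE mulmxDr mxE. Qed.

Lemma dotvZr a x y : dotv x (a *: y) = a * dotv x y.
Proof. by rewrite !dotvE -scalemxAr mxE. Qed.

Lemma dotvDl x y z : dotv (x + y) z = dotv x z + dotv y z.
Proof. by rewrite !(dotvC _ z) dotvDr. Qed.

Lemma dotvZl a x y : dotv (a *: x) y = a * dotv x y.
Proof. by rewrite !(dotvC _ y) dotvZr. Qed.

Lemma dotv_scaleE a x :
  dotv (a *: x) (a *: x) = a ^+ 2 * dotv x x.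
Proof. by rewrite dotvZl dotvZr mulrA -expr2. Qed.

Lemma dotv0l x : dotv 0 x = 0.
Proof. by rewrite -(scale0r x) dotvZl mul0r. Qed.

Lemma dotv_mulmxl D x y : dotv (D *m x) y = dotv x (D^T *m y).
Proof. by rewrite !dotvE trmx_mul mulmxA. Qed.

Lemma dotvv_ge0 x : 0 <= dotv x x.
Proof. by apply: sumr_ge0 => i _; rewrite -expr2 sqr_ge0. Qed.

Lemma dotvv_eq0 x : dotv x x = 0 -> x = 0.
Proof.
move=> /eqP; rewrite psumr_eq0 => [/allP x0|i _]; last by rewrite -expr2 sqr_ge0.
apply/matrixP => i j; rewrite ord1 mxE; apply/eqP.
by have := x0 i (mem_index_enum i); rewrite /= mulf_eq0 orbb.
Qed.

Lemma enorm_eq1 x : enorm x = 1 <-> dotv x x = 1.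
Proof.
split=> [x1|xx1]; last by rewrite /enorm xx1 sqrtr1.
by rewrite -(sqr_sqrtr (dotvv_ge0 x)) -/(enorm x) x1 expr1n.
Qed.

Lemma dotv_sub_scale t x y :
  dotv (y - t *: x) (y - t *: x) =
    dotv y y - 2 * t * dotv x y + t ^+ 2 * dotv x x.
Proof.
by rewrite -scaleNr !dotvDl !dotvDr !dotvZl !dotvZr (dotvC y x); ring.
Qed.

End DotProduct.

(** * The norm of a symmetric matrix *)

Section SpectralBound.
Context {R : realType} {n : nat}.
Implicit Types (x y v w : 'cV[R]_n) (D : 'M[R]_n).

(** Rows rather than columns, because the compactness criterion used below is
    about row vectors. *)
Lemma continuous_dotv_mulmx D :
  continuous (fun v : 'rV[R]_n => dotv (D *m v^T) (D *m v^T)).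
Proof.
have cont_sum (h : 'I_n -> 'rV[R]_n -> R) :
    (forall i, continuous (h i)) ->
    continuous (fun v : 'rV[R]_n => \sum_(i < n) h i v).
  by move=> hc; apply: continuous_big => // -[a b]; exact: add_continuous.
have cont_coord i : continuous (fun v : 'rV[R]_n => (D *m v^T) i 0).
  under eq_fun do rewrite mxE.
  apply: (cont_sum (fun j (v : 'rV_n) => D i j * v^T j 0)) => j v.
  under eq_fun do rewrite mxE.
  by apply: continuousM; [exact: cst_continuous|exact: coord_continuous].
apply: (cont_sum (fun i (v : 'rV_n) => (D *m v^T) i 0 * (D *m v^T) i 0)) => i v.
by apply: continuousM; exact: cont_coord.
Qed.

Lemma eigenvalue_sym D x a :
  D^T = D -> x != 0 -> D *m x = a *: x -> eigenvalue D a.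
Proof.
move=> Dsym x0 Dx; apply/eigenvalueP; exists x^T; last by rewrite trmx_eq0.
by rewrite -{1}Dsym -trmx_mul Dx linearZ.
Qed.

(** Because D^2 - s^2 = (D + s) (D - s), either (D - s) x vanishes or it is an
    eigenvector for - s. *)
Lemma eigenvalue_of_square D x s :
  D^T = D -> x != 0 -> D *m (D *m x) = s ^+ 2 *: x ->
  eigenvalue D s \/ eigenvalue D (- s).
Proof.
move=> Dsym x0 DDx; have [Dx|u0] := eqVneq (D *m x - s *: x) 0.
  by left; apply: (eigenvalue_sym Dsym x0); apply/eqP; rewrite -subr_eq0 Dx.
right; apply: (eigenvalue_sym Dsym u0).
rewrite mulmxBr DDx -scalemxAr scalerBr !scaleNr scalerA -expr2 opprK.
by rewrite addrC.
Qed.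

(** The quadratic form m |v|^2 - |D v|^2 is nonnegative and vanishes at x, so
    its gradient there, twice the vector w below, is zero: otherwise the form
    would become negative on moving from x against w. *)
Lemma rayleigh_maximizer D x m :
  D^T = D -> (forall v, dotv (D *m v) (D *m v) <= m * dotv v v) ->
  dotv (D *m x) (D *m x) = m * dotv x x -> D *m (D *m x) = m *: x.
Proof.
move=> Dsym max eqx.
pose w := m *: x - D *m (D *m x).
pose c := m * dotv w w - dotv (D *m w) (D *m w).
have c0 : 0 <= c by rewrite subr_ge0.
have wE : dotv w w = m * dotv x w - dotv (D *m x) (D *m w).
  rewrite {1}/w -scaleN1r dotvDl !dotvZl (dotv_mulmxl D (D *m x)) Dsym.
  by ring.
suff w0 : dotv w w = 0.
  by apply/esym/eqP; rewrite -subr_eq0; apply/eqP/dotvv_eq0.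
have quad t : 0 <= t ^+ 2 * c - 2 * t * dotv w w.
  have := max (x - t *: w).
  rewrite mulmxBr -scalemxAr !dotv_sub_scale eqx -subr_ge0.
  rewrite (dotvC w x) (dotvC (D *m w) (D *m x)) /c wE.
  by congr (_ <= _); ring.
apply/eqP; rewrite eq_le dotvv_ge0 andbT leNgt; apply/negP => a0.
set a := dotv w w in a0 quad.
(* The form in quad is negative for 0 < t < 2 a / c; dividing by c + 1 instead
   of c also covers c = 0. *)
have := quad (a / (c + 1)).
have c1 : 0 < c + 1 by lra.
suff -> : (a / (c + 1)) ^+ 2 * c - 2 * (a / (c + 1)) * a =
    - (a ^+ 2 * (c + 2) / (c + 1) ^+ 2).
  rewrite oppr_ge0 leNgt => /negP; apply.
  by rewrite divr_gt0 ?exprn_gt0// mulr_gt0 ?exprn_gt0//; lra.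
by field; rewrite gt_eqF.
Qed.

End SpectralBound.

(** Extreme value theorem on the unit sphere, then homogeneity. *)
Lemma exists_operator_norm_vector {R : realType} {n : nat} (D : 'M[R]_n.+1) :
  exists2 x, dotv x x = 1 &
    forall v, dotv (D *m v) (D *m v) <= dotv (D *m x) (D *m x) * dotv v v.
Proof.
pose S := [set v : 'rV[R]_n.+1 | dotv v^T v^T = 1].
have SE :
    S = (fun v : 'rV[R]_n.+1 => dotv (1%:M *m v^T) (1%:M *m v^T)) @^-1` [set 1].
  by apply/seteqP; split => v; rewrite /S /= mul1mx.
have S0 : S !=set0.
  exists (delta_mx 0 0 : 'cV_n.+1)^T; rewrite /S /= trmxK.
  by apply/enorm_eq1; have := unit_sphere_delta R n; rewrite inE.
have S_closed : closed S.
  rewrite SE; apply: preimage_closed; last exact: closed_eq.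
  by move=> v _; exact: continuous_dotv_mulmx.
(* The ambient norm is the sup norm, so each coordinate has to be bounded. *)
have S_bounded : bounded_set S.
  exists 1; split => // M M1 v /= v1.
  apply: le_trans (ltW M1); rewrite /Num.norm /= mx_normrE.
  apply/bigmax_leP; split => //= -[i j] _ /=.
  rewrite ord1 -(ler_pXn2r (n := 2))// ?nnegrE// expr1n -normrX ger0_norm ?sqr_ge0//.
  rewrite -v1 /dotv (bigD1 j)//= mxE -expr2 lerDl sumr_ge0// => k _.
  by rewrite -expr2 sqr_ge0.
have [x Sx xmax] := EVT_max_rV S0 (bounded_closed_compact S_bounded S_closed)
  (continuous_subspaceT (@continuous_dotv_mulmx R n.+1 D)).
move: Sx; rewrite inE => Sx.
exists x^T => // v.
have [->|v0] := eqVneq v 0; first by rewrite mulmx0 !dotv0l mulr0.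
pose r := Num.sqrt (dotv v v).
have r2 : r ^+ 2 = dotv v v by rewrite sqr_sqrtr ?dotvv_ge0.
have vv0 : dotv v v != 0 by apply: contra_neq v0 => /dotvv_eq0.
have /xmax : (r^-1 *: v)^T \in S.
  by rewrite inE /S /= trmxK dotv_scaleE exprVn r2 mulVf.
rewrite trmxK -scalemxAr dotv_scaleE exprVn r2 mulrC ler_pdivrMr//.
by rewrite lt_neqAle eq_sym vv0 dotvv_ge0.
Qed.

(** A maximizer of |D v| on the sphere is an eigenvector of D^2 for the maximum
    of |D v|^2, and a square root of that maximum is an eigenvalue of D, hence
    at most |c| in absolute value. *)
Lemma symmetric_norm_bound {R : realType} {n : nat} (D : 'M[R]_n.+1) c :
  D^T = D -> (forall a, eigenvalue D a -> `|a| <= `|c|) ->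
  forall v, dotv (D *m v) (D *m v) <= c ^+ 2 * dotv v v.
Proof.
move=> Dsym Dc v; have [x x1 xmax] := exists_operator_norm_vector D.
have x0 : x != 0.
  apply: contra_eq_neq x1 => ->.
  by rewrite dotv0l eq_sym oner_neq0.
set m := dotv (D *m x) (D *m x) in xmax.
have m0 : 0 <= m by exact: dotvv_ge0.
pose s := Num.sqrt m.
have s2 : s ^+ 2 = m by rewrite sqr_sqrtr.
have DDx : D *m (D *m x) = s ^+ 2 *: x.
  by rewrite s2; apply: rayleigh_maximizer => //; rewrite x1 mulr1.
have sc : `|s| <= `|c|.
  by have [/Dc//|/Dc] := eigenvalue_of_square Dsym x0 DDx; rewrite normrN.
apply: le_trans (xmax v) _; apply: ler_wpM2r; first exact: dotvv_ge0.
rewrite -s2 -[leLHS]real_normK ?num_real// -[leRHS]real_normK ?num_real//.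
by rewrite ler_pXn2r ?nnegrE.
Qed.

(** Cauchy-Schwarz, read off from |D y - t x|^2 >= 0 at t = x . D y. *)
Lemma dotv_mulmx_bound {R : realType} {n : nat} (D : 'M[R]_n) c x y :
  (forall v, dotv (D *m v) (D *m v) <= c ^+ 2 * dotv v v) ->
  dotv x x = 1 -> dotv y y = 1 -> `|dotv x (D *m y)| <= `|c|.
Proof.
move=> Dc x1 y1; rewrite -(ler_pXn2r (n := 2))// ?nnegrE//.
rewrite !real_normK ?num_real//.
have := Dc y; rewrite y1 mulr1; apply: le_trans.
have := dotvv_ge0 (D *m y - dotv x (D *m y) *: x).
by rewrite dotv_sub_scale x1; nra.
Qed.

(** Equality case of Cauchy-Schwarz: expanding gives
    |D y - c x|^2 = |D y|^2 - c^2 <= 0. *)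
Lemma dotv_mulmx_extremal {R : realType} {n : nat} (D : 'M[R]_n) c x y :
  (forall v, dotv (D *m v) (D *m v) <= c ^+ 2 * dotv v v) ->
  dotv x x = 1 -> dotv y y = 1 -> dotv x (D *m y) = c -> D *m y = c *: x.
Proof.
move=> Dc x1 y1 xy; apply/eqP; rewrite -subr_eq0; apply/eqP/dotvv_eq0.
apply/eqP; rewrite eq_le dotvv_ge0 andbT dotv_sub_scale xy x1.
by have := Dc y; rewrite y1 mulr1; lra.
Qed.

(** * Means with respect to a probability measure *)

Section ProbabilityMean.
Context d (T : measurableType d) (R : realType) (P : probability T R).
Implicit Types (f : T -> R) (a b c : R).

Lemma itv_integrable f a b :
  measurable_fun setT f -> (forall x, a <= f x <= b) ->
  P.-integrable setT (EFin \o f).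
Proof.
move=> mf fab; apply: measurable_bounded_integrable => //.
  by apply: le_lt_trans (probability_le1 P measurableT) _; rewrite ltry.
exists (`|a| + `|b|); split; first by rewrite num_real.
move=> M ltM x _ /=; apply: le_trans (ltW ltM).
have /andP[fa fb] := fab x.
have := ler_norm b; have := lerNnormlW (lexx `|a|).
have := normr_ge0 a; have := normr_ge0 b.
by rewrite ler_norml => *; apply/andP; split; lra.
Qed.

Lemma Rintegral_prob_cst c : \int[P]_x c = c.
Proof.
have P1 : P setT = 1%E by exact: probability_setT.
by rewrite Rintegral_cst//= P1 mulr1.
Qed.

Lemma mean_le f c : P.-integrable setT (EFin \o f) ->
  (forall x, f x <= c) -> \int[P]_x f x <= c.
Proof.
move=> intf fc; rewrite -[leRHS]Rintegral_prob_cst.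
by apply: le_Rintegral => //; exact: finite_measure_integrable_cst.
Qed.

Lemma le_mean f c : P.-integrable setT (EFin \o f) ->
  (forall x, c <= f x) -> c <= \int[P]_x f x.
Proof.
move=> intf fc; rewrite -[leLHS]Rintegral_prob_cst.
by apply: le_Rintegral => //; exact: finite_measure_integrable_cst.
Qed.

Lemma mean_itv f a b :
  measurable_fun setT f -> (forall x, a <= f x <= b) ->
  a <= \int[P]_x f x <= b.
Proof.
move=> mf fab; have intf := itv_integrable mf fab.
by apply/andP; split; [apply: le_mean|apply: mean_le] => // x;
  have /andP[] := fab x.
Qed.

Lemma probability_ae_ex (Q : T -> Prop) : {ae P, forall x, Q x} -> exists x, Q x.
Proof.
have P0 : (0 < P setT)%E.
  have P1 : P setT = 1%E by exact: probability_setT.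
  by rewrite P1 lte01.
have ? := ae_properfilter_algebraOfSetsType P0.
exact: filter_ex.
Qed.

(** Under either hypothesis f - c has constant sign, so the integral of |f - c|
    is, up to sign, the difference of the two means, which is 0. *)
Lemma mean_extremal_ae f c :
  P.-integrable setT (EFin \o f) ->
  (forall x, f x <= c) \/ (forall x, c <= f x) ->
  \int[P]_x f x = c -> {ae P, forall x, f x = c}.
Proof.
move=> intf fc intfc.
have icst : P.-integrable setT (EFin \o cst c).
  exact: finite_measure_integrable_cst.
have idiff : P.-integrable setT (EFin \o (fun x => f x - c)).
  exact: (integrableB _ intf icst).
have diff0 : (\int[P]_x (f x - c)%:E = 0)%E.
  rewrite -(fineK (integrable_fin_num _ idiff))//.
  rewrite -[fine _]/(Rintegral P setT (fun x => f x - c)).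
  by rewrite RintegralB// intfc Rintegral_prob_cst subrr.
have abs0 : (\int[P]_x `|(f x - c)%:E| = 0)%E.
  case: fc => fc; last first.
    rewrite -[RHS]diff0; apply: eq_integral => x _.
    by rewrite gee0_abs// lee_fin subr_ge0.
  rewrite -[RHS]oppe0 -[in RHS]diff0 -integralN//; last first.
    exact: integrable_add_def.
  by apply: eq_integral => x _; rewrite lee0_abs// lee_fin subr_le0.
have mdiff := measurable_int P idiff.
have [N [mN N0 fN]] := (ae_eq_integral_abs P measurableT mdiff).1 abs0.
exists N; split => // x /= fx; apply: fN => /= /(_ I) [/eqP].
by rewrite subr_eq0 => /eqP.
Qed.

End ProbabilityMean.

(** * The energy on the sphere *)

Section EnergyOnSphere.
Context {R : realType} {n : nat}.
Implicit Types (D : 'M[R]_n.+1) (mu : probability (borel_sphere R n) R).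

Lemma dotv_sphere (x : sphere R n) : dotv (sphere_val x) (sphere_val x) = 1.
Proof. by apply/enorm_eq1; have := valP x; rewrite inE. Qed.

Lemma measurable_sphere_coord i :
  measurable_fun setT (fun x : borel_sphere R n => sphere_val x i 0).
Proof.
apply: (measurability _ (RGenOpens.measurableE R)) => _ [_ [a [b ->] <-]].
rewrite setTI; apply: sub_sigma_algebra.
apply: open_comp; last exact: interval_open.
move=> x _.
by apply: (@continuous_comp (sphere R n) _ _ (@sphere_val R n)
  (fun M : 'cV[R]_n.+1 => M i 0));
  [exact: initial_continuous|exact: coord_continuous].
Qed.

Definition gibbs D (x y : sphere R n) : R :=
  expR (dotv (sphere_val x) (D *m sphere_val y)).

(** Joint measurability, which makes the inner mean measurable in y. It goes
    through coordinates, since pairs carry the product sigma-algebra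
    and not the Borel one of the product topology. *)
Lemma measurable_gibbs D :
  measurable_fun setT (fun p : borel_sphere R n * borel_sphere R n =>
    gibbs D p.1 p.2).
Proof.
apply: measurableT_comp => //.
apply: measurable_sum => i; apply: measurable_funM.
  exact: (measurableT_comp (measurable_sphere_coord i) measurable_fst).
under eq_fun do rewrite mxE.
apply: measurable_sum => j; apply: measurable_funM => //.
exact: (measurableT_comp (measurable_sphere_coord j) measurable_snd).
Qed.

Lemma measurable_gibbsl D (y : borel_sphere R n) :
  measurable_fun setT (fun x : borel_sphere R n => gibbs D x y).
Proof. exact: measurableT_comp (measurable_gibbs D) (measurable_pair2 y). Qed.

(** One norm bound yields both the two-sided estimate of [gibbs] and, because
    [gibbs] is then bounded, the integrability of it and of its means. *)
Section BoundedForm.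
Variables (D : 'M[R]_n.+1) (c : R).
Hypothesis Dc : forall v, dotv (D *m v) (D *m v) <= c ^+ 2 * dotv v v.

Let gibbs_itv x y : expR (- `|c|) <= gibbs D x y <= expR `|c|.
Proof.
rewrite !ler_expR -ler_norml; apply: dotv_mulmx_bound => //; exact: dotv_sphere.
Qed.

Let mean_gibbs mu (y : borel_sphere R n) := \int[mu]_x gibbs D x y.

Let gibbs_integrable mu y :
  mu.-integrable setT (EFin \o (fun x : borel_sphere R n => gibbs D x y)).
Proof.
apply: itv_integrable => [|x]; [exact: measurable_gibbsl|exact: gibbs_itv].
Qed.

Let mean_gibbsE mu y :
  (mean_gibbs mu y)%:E = (\int[mu]_x (gibbs D x y)%:E)%E.
Proof. by rewrite fineK//; exact: integrable_fin_num (gibbs_integrable _ _). Qed.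

Let mean_gibbs_itv mu y : expR (- `|c|) <= mean_gibbs mu y <= expR `|c|.
Proof. by apply: mean_itv => [|x]; [exact: measurable_gibbsl|]. Qed.

Let measurable_mean_gibbs mu : measurable_fun setT (mean_gibbs mu).
Proof.
apply/measurable_EFinP; rewrite /comp.
under eq_fun do rewrite mean_gibbsE.
apply: (measurable_fun_fubini_tonelli_F
  (fun p : borel_sphere R n * borel_sphere R n => (gibbs D p.2 p.1)%:E)) => [|p].
  apply/measurable_EFinP.
  exact: (measurableT_comp (measurable_gibbs D)
    (@measurable_swap _ _ (borel_sphere R n) (borel_sphere R n))).
by rewrite lee_fin expR_ge0.
Qed.

Let mean_gibbs_integrable mu : mu.-integrable setT (EFin \o mean_gibbs mu).
Proof. by apply: itv_integrable. Qed.

Let energyE mu : energy D mu = (\int[mu]_y mean_gibbs mu y)%:E.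
Proof.
rewrite fineK; last exact: integrable_fin_num (mean_gibbs_integrable _).
by apply: eq_integral => y _; rewrite mean_gibbsE.
Qed.

Lemma energy_itv mu : ((expR (- `|c|))%:E <= energy D mu <= (expR `|c|)%:E)%E.
Proof. by rewrite energyE !lee_fin; apply: mean_itv. Qed.

Lemma energy_dirac mu z : is_dirac mu z -> energy D mu = (gibbs D z z)%:E.
Proof.
move=> muz.
have int_mu (f : borel_sphere R n -> \bar R) :
    measurable_fun setT f -> (\int[mu]_x f x = f z)%E.
  move=> mf; rewrite (eq_measure_integral (\d_z)) => [|A mA _]; last exact: muz.
  by rewrite integral_dirac// diracT mul1e.
rewrite /energy -[LHS]/(\int[mu]_y \int[mu]_x (gibbs D x y)%:E)%E.
rewrite int_mu.
  by apply: int_mu; apply/measurable_EFinP; exact: measurable_gibbsl.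
have : measurable_fun setT (EFin \o mean_gibbs mu) by apply/measurable_EFinP.
by rewrite /comp; under eq_fun do rewrite mean_gibbsE.
Qed.

(** The energy is a mean of means of [gibbs], which stays on one side of
    exp c; hence equality propagates to almost every y, then to almost every
    x, and pins x down to the single point D y / c. *)
Lemma energy_extremal_dirac mu : c != 0 -> energy D mu = (expR c)%:E ->
  exists2 z, unit_eigenvectors D c z & is_dirac mu z.
Proof.
move=> c0 muc.
have extremal : (forall x y, gibbs D x y <= expR c) \/
    (forall x y, expR c <= gibbs D x y).
  case: (leP 0 c) => [c_ge0|c_lt0]; [left|right] => x y;
    have /andP[] := gibbs_itv x y.
    by rewrite (ger0_norm c_ge0).
  by rewrite (ltr0_norm c_lt0) opprK.
have [y yc] : exists y, mean_gibbs mu y = expR c.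
  apply: (probability_ae_ex (P := mu)); apply: mean_extremal_ae => //.
    case: extremal => ext; [left|right] => y; [apply: mean_le|apply: le_mean];
      by [exact: gibbs_integrable|].
  by move: muc; rewrite energyE => -[].
have ae_eigen : {ae mu, forall x, D *m sphere_val y = c *: sphere_val x}.
  have := mean_extremal_ae (gibbs_integrable mu y) _ yc.
  case/(_ _)/Wrap => [|[N [mN N0 NS]]].
    by case: extremal => ext; [left|right] => x.
  exists N; split => // x /= xc; apply: NS => /= /expR_inj xyc; apply: xc.
  by apply: dotv_mulmx_extremal => //; exact: dotv_sphere.
have [z yz] := probability_ae_ex ae_eigen.
have muz : is_dirac mu z.
  have ae_z : {ae mu, forall x, x = z}.
    have [N [mN N0 NS]] := ae_eigen.
    exists N; split => // x /= xz; apply: NS => /= yx; apply: xz.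
    by apply: val_inj; apply: (scalerI c0); rewrite -[LHS]yx -[RHS]yz.
  have [N [mN N0 NS]] := ae_z.
  move=> A mA; rewrite diracE; have [zA|zA] := boolP (z \in A).
    have /eqP : mu (~` A) = 0%E.
      apply: measure_negligible; first exact: measurableC.
      exists N; split => // x nA; apply: NS => /= xz; apply: nA.
      by rewrite xz; exact: set_mem.
    by rewrite probability_setC// sube_eq// ?add0e => /eqP.
  apply: measure_negligible => //; exists N; split => // x Ax; apply: NS => /= xz.
  by move/negP: zA; apply; rewrite -xz; exact: mem_set.
exists z => //; apply: dotv_mulmx_extremal; rewrite ?dotv_sphere//.
by apply: expR_inj; move: muc; rewrite (energy_dirac muz) => -[].
Qed.

Lemma energy_eq_expR mu : c != 0 ->
  energy D mu = (expR c)%:E <->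
  exists2 z, unit_eigenvectors D c z & is_dirac mu z.
Proof.
move=> c0; split=> [/energy_extremal_dirac|[z Dz muz]]; first exact.
by rewrite (energy_dirac muz) /gibbs Dz dotvZr dotv_sphere mulr1.
Qed.

End BoundedForm.

Lemma eigenvalue_unit_eigenvector D a : D^T = D -> eigenvalue D a ->
  exists z, unit_eigenvectors D a z.
Proof.
move=> Dsym /eigenvalueP[v Dv v0].
pose w := v^T; pose r := Num.sqrt (dotv w w).
have w0 : dotv w w != 0.
  by apply: contra_neq v0 => /dotvv_eq0 w0; rewrite -(trmxK v) -/w w0 trmx0.
have wS : r^-1 *: w \in @unit_sphere R n.+1.
  rewrite inE; apply/enorm_eq1; rewrite dotv_scaleE exprVn sqr_sqrtr ?dotvv_ge0//.
  by rewrite mulVf.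
exists (exist _ (r^-1 *: w) wS : sphere R n).
rewrite /unit_eigenvectors /= /sphere_val /=.
rewrite -scalemxAr scalerA mulrC -scalerA; congr (_ *: _).
by rewrite -[in LHS]Dsym -trmx_mul Dv linearZ.
Qed.

(** A competitor showing that the bound exp a is reached, so that extremal
    measures must reach it too. *)
Lemma energy_attained D a : D^T = D -> max_abs_eigenvalue D a -> a != 0 ->
  exists mu : probability (borel_sphere R n) R, energy D mu = (expR a)%:E.
Proof.
move=> Dsym [aD amax] a0; have [z Dz] := eigenvalue_unit_eigenvector Dsym aD.
exists (dirac z : probability (borel_sphere R n) R).
by apply/(energy_eq_expR (symmetric_norm_bound Dsym amax) _ a0); exists z.
Qed.

End EnergyOnSphere.

(** * Extremal measures *)

Theorem theorem3p1 (R : realType) (n : nat) (D : 'M[R]_n.+1) (lambda : R)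
    (D_symmetric : D^T = D) (lambda_max : max_abs_eigenvalue D lambda) :
  (0 < lambda ->
     forall mu : probability (borel_sphere R n) R,
       energy_maximizer D mu <->
       exists2 z, unit_eigenvectors D lambda z & is_dirac mu z) /\
  (lambda < 0 ->
     forall mu : probability (borel_sphere R n) R,
       energy_minimizer D mu <->
       exists2 z, unit_eigenvectors D lambda z & is_dirac mu z).
Proof.
have bound := symmetric_norm_bound D_symmetric lambda_max.2.
have attained := energy_attained D_symmetric lambda_max.
split=> l0 mu.
  have l_neq0 : lambda != 0 by rewrite gt_eqF.
  have ub nu : (energy D nu <= (expR lambda)%:E)%E.
    by have /andP[_] := energy_itv bound nu; rewrite gtr0_norm.
  rewrite -(energy_eq_expR bound mu l_neq0); split=> [mumax|muE nu].
    have [nu nuE] := attained l_neq0.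
    by apply/eqP; rewrite eq_le ub -nuE mumax.
  by rewrite muE.
have l_neq0 : lambda != 0 by rewrite lt_eqF.
have lb nu : ((expR lambda)%:E <= energy D nu)%E.
  by have /andP[+ _] := energy_itv bound nu; rewrite ltr0_norm// opprK.
rewrite -(energy_eq_expR bound mu l_neq0); split=> [mumin|muE nu].
  have [nu nuE] := attained l_neq0.
  by apply/eqP; rewrite eq_le lb -nuE mumin.
by rewrite muE.
Qed.
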